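(* Let $d,\tau\in\mathbb{N}$, $L>0$, $R>0$, $\gamma>0$. Let $\mathcal{K}\subset\mathbb{R}^d$ be a closed convex set with $0\in\mathcal{K}$ and $\|x\|\le R$ for all $x\in\mathcal{K}$, let $x_u^t,x_k^t\in\mathcal{K}$ for all $t\ge 1$ (so $\|x_k^t\|\le R$), and let $f_t\in\mathcal{F}$ ($t\ge 1$) be $\gamma$-strongly convex losses that are $L$-Lipschitz on $\mathcal{K}$, so that $\|\nabla f_t(x)\|\le L$ for $x\in\mathcal{K}$. Run the Delayed Correlated Online Gradient Descent algorithm with delay $\tau$, influence functions $\Phi_{t}(x)=\lambda_{t}x$, and parameters $$\eta_t=\beta_t=|\lambda_t|=\frac{1}{\gamma(t-\tau)}\quad(t>\tau).$$ Put $L'=L+R/\gamma$. Then the regret $R(T)=\sum_{t=1}^T f_t(\hat{x}_u^t)-\min_{x\in\mathcal{K}}\sum_{t=1}^T f_t(x)$ satisfies $$R(T)\le 2\gamma\tau R^2+\frac{2R^2}{\gamma}H(T)+\Big(\frac12+\tau\Big)L'^2\,\frac{1}{\gamma}H(T-\tau)\le C_2\,\tau\log T,$$ where $H(n)=\sum_{j=1}^n \frac1j$ denotes the harmonic number and $C_2$ is a constant independent of $T$ and $\tau$.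
   Context: $\|\cdot\|$ is the Euclidean norm on $\mathbb{R}^d$. At each round $t$ an agent has a known context $x_k^t\in\mathbb{R}^d$ and an unknown context $x_u^t\in\mathbb{R}^d$, the latter revealed only after a fixed delay of $\tau$ rounds; no distributional assumption is made on either sequence. Class $\mathcal{F}$: the convex functions $f_t:\mathbb{R}^d\to[0,\infty)$ of the form $f_t(x)=f(\|x-x_u^t\|)$, where $f:[0,\infty)\to[0,\infty)$ (possibly depending on $t$) is increasing with $f(0)=0$. $\nabla f_t(x)$ denotes the gradient (a subgradient where $f_t$ is not differentiable). $f_t$ is $\gamma$-strongly convex if $f_t(x)\ge f_t(y)+\langle\nabla f_t(y),x-y\rangle+\frac{\gamma}{2}\|x-y\|^2$ for all $x,y$. Delayed Correlated Online Gradient Descent. Inputs: step sizes $\eta_t$, delay $\tau$, influence functions $\Phi_t:\mathbb{R}^d\to\mathbb{R}^d$, weights $\beta_t$. Set $\hat{x}_u^1=\dots=\hat{x}_u^{\tau}=\hat{x}_u^{\tau+1}=0$. For $t\ge\tau+1$: incur loss $f_t(\hat{x}_u^t)$; compute $g_{t-\tau}=\nabla f_{t-\tau}(\hat{x}_u^{t-\tau})$; update $$\hat{x}_u^{t+1}=\hat{x}_u^t-\eta_t g_{t-\tau}+\beta_t\Phi_{t+1}(x_k^{t+1}),$$ and, if this point lies outside $\mathcal{K}$, replace it by its Euclidean projection onto $\mathcal{K}$. The signs of the $\lambda_t$ are arbitrary. The quantity $L'$ is an upper bound on the norms of the modified gradients $g_{t-\tau}-\frac{\beta_t}{\eta_t}\Phi_{t+1}(x_k^{t+1})$,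 $t>\tau$.
   Formalization: The delay is taken to be τ ≥ 1 and the bound is claimed for T > τ only (at T = τ = 1 the last bound is 0 while the middle one is positive); ‖∇f_t(x)‖ ≤ L on K is assumed, as it does not follow from L-Lipschitz on K. *)

(* Defs.v *)
From HB Require Import structures.
From mathcomp Require Import all_boot all_order all_algebra.
From mathcomp Require Import all_classical all_reals all_analysis.
Import Order.TTheory GRing.Theory Num.Theory numFieldNormedType.Exports.

Set Implicit Arguments.
Unset Strict Implicit.
Unset Printing Implicit Defensive.

Local Open Scope classical_set_scope.
Local Open Scope ring_scope.

Definition dot {R : realType} {d : nat} (u v : 'rV[R]_d) : R :=
  \sum_(i < d) u 0 i * v 0 i.

(* The library norm [`|u|] on ['rV[R]_d] is the sup norm; it induces the same
   topology, so [closed] and [differentiable] can be used unchanged. *)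
Definition enorm {R : realType} {d : nat} (u : 'rV[R]_d) : R :=
  Num.sqrt (dot u u).

(* "Increasing" is read weakly. *)
Definition in_classF {R : realType} {d : nat} (xu : 'rV[R]_d)
    (f : 'rV[R]_d -> R) : Prop :=
  convex_function [set: 'rV[R]_d] f /\
  exists phi : R -> R,
    [/\ forall r, 0 <= r -> 0 <= phi r,
        forall r s, 0 <= r -> r <= s -> phi r <= phi s,
        phi 0 = 0
      & forall x, f x = phi (enorm (x - xu))].

Definition subgradient {R : realType} {d : nat} (f : 'rV[R]_d -> R)
    (x g : 'rV[R]_d) : Prop :=
  forall y, f x + dot g (y - x) <= f y.

(* [g] is a choice of "nabla f": an arbitrary subgradient is selected at each
   point where [f] is not differentiable. *)
Definition gradient_map {R : realType} {d : nat} (f : 'rV[R]_d -> R)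
    (g : 'rV[R]_d -> 'rV[R]_d) : Prop :=
  forall x,
    (differentiable f x -> forall v, 'd f x v = dot (g x) v) /\
    (~ differentiable f x -> subgradient f x (g x)).

Definition strongly_convex {R : realType} {d : nat} (gamma : R)
    (f : 'rV[R]_d -> R) (g : 'rV[R]_d -> 'rV[R]_d) : Prop :=
  forall x y,
    f y + dot (g y) (x - y) + gamma / 2 * enorm (x - y) ^+ 2 <= f x.

Definition lipschitz_in {R : realType} {d : nat} (K : set 'rV[R]_d) (L : R)
    (f : 'rV[R]_d -> R) : Prop :=
  forall x y, K x -> K y -> `|f x - f y| <= L * enorm (x - y).

Definition is_projection {R : realType} {d : nat} (K : set 'rV[R]_d)
    (y p : 'rV[R]_d) : Prop :=
  K p /\ forall z, K z -> enorm (y - p) <= enorm (y - z).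

(* [xhat] is the run of Delayed Correlated Online Gradient Descent; rounds are
   numbered from 1 and the values at index 0 are never used. [grad t] is the
   gradient map of the loss of round [t]. *)
Definition DCOGD_run {R : realType} {d : nat} (K : set 'rV[R]_d) (tau : nat)
    (eta beta : nat -> R) (Phi : nat -> 'rV[R]_d -> 'rV[R]_d)
    (grad : nat -> 'rV[R]_d -> 'rV[R]_d) (xk xhat : nat -> 'rV[R]_d) : Prop :=
  (forall t, (1 <= t <= tau.+1)%N -> xhat t = 0) /\
  (forall t, (tau < t)%N ->
     let g := grad (t - tau)%N (xhat (t - tau)%N) in
     let y := xhat t - eta t *: g + beta t *: Phi t.+1 (xk t.+1) in
     (K y -> xhat t.+1 = y) /\
     (~ K y -> is_projection K y (xhat t.+1))).

(* [r] is the regret after [T] rounds; the minimum over [K] is required to be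
   attained. *)
Definition is_regret {R : realType} {d : nat} (K : set 'rV[R]_d)
    (f : nat -> 'rV[R]_d -> R) (xhat : nat -> 'rV[R]_d) (T : nat) (r : R)
    : Prop :=
  exists xmin : 'rV[R]_d,
    [/\ K xmin,
        forall x, K x ->
          \sum_(1 <= t < T.+1) f t xmin <= \sum_(1 <= t < T.+1) f t x
      & r = \sum_(1 <= t < T.+1) f t (xhat t)
            - \sum_(1 <= t < T.+1) f t xmin].

Definition H {R : realType} (n : nat) : R := \sum_(1 <= j < n.+1) j%:R^-1.

(* Main.v *)
(* Let m = T - tau, a_s = |xhat_s - z|^2 for a competitor z in K, and let c_t be
   the length of the path of iterates up to time t.  Strong convexity bounds the
   gap of round s by <g_s, xhat_s - z> - gamma/2 a_s.
   For s <= m the gradient g_s is used at time s + tau, and the projected step gives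
   <g_s, xhat_(s+tau) - z> <= gamma s/2 (a_(s+tau) - a_(s+tau+1)) + O(1/s); replacing
   xhat_s by xhat_(s+tau) costs at most L (c_(s+tau) - c_s).
   For m < s <= T the gradient is never used and xhat_s is compared with xhat_(T+1)
   at the cost L (c_(T+1) - c_s).
   In the sum over s <= T the shifted a's cancel, and the path lengths add up to at
   most tau c_(T+1), which leaves tau L q - gamma/2 m q^2 with q = |xhat_(T+1) - z|.
   As the first move is at most 2 Rad, c_(T+1) <= 2 Rad + L'/gamma (H m - 1), and
   for tau <= m two completed squares absorb everything into the stated bound.
   For m < tau each round costs at most L^2/(2 gamma), which is enough. *)
Require Import Defs.
From HB Require Import structures.
From mathcomp Require Import all_boot all_order all_algebra.
From mathcomp Require Import all_classical all_reals all_analysis.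
From mathcomp Require Import ring lra.
Import Order.TTheory GRing.Theory Num.Theory numFieldNormedType.Exports.

Local Open Scope classical_set_scope.
Local Open Scope ring_scope.

(** * Euclidean geometry of row vectors: Cauchy-Schwarz, compactness, projections *)

Section EuclideanSpace.
Context {R : realType} {d : nat}.
Implicit Types (u v w : 'rV[R]_d) (K : set 'rV[R]_d).

Lemma dotC u v : dot u v = dot v u.
Proof. by apply: eq_bigr => i _; rewrite mulrC. Qed.

Lemma dotDl u v w : dot (u + v) w = dot u w + dot v w.
Proof. by rewrite -big_split; apply: eq_bigr => i _; rewrite !mxE mulrDl. Qed.

Lemma dotDr u v w : dot w (u + v) = dot w u + dot w v.
Proof. by rewrite dotC dotDl ![dot w _]dotC. Qed.

Lemma dotZl a u v : dot (a *: u) v = a * dot u v.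
Proof. by rewrite mulr_sumr; apply: eq_bigr => i _; rewrite !mxE mulrA. Qed.

Lemma dotZr a u v : dot u (a *: v) = a * dot u v.
Proof. by rewrite dotC dotZl dotC. Qed.

Lemma dotNl u v : dot (- u) v = - dot u v.
Proof. by rewrite -scaleN1r dotZl mulN1r. Qed.

Lemma dotNr u v : dot u (- v) = - dot u v.
Proof. by rewrite dotC dotNl dotC. Qed.

Definition dotE := (dotDl, dotDr, dotNl, dotNr, dotZl, dotZr).

Lemma dot_ge0 u : 0 <= dot u u.
Proof. by apply: sumr_ge0 => i _; rewrite -expr2 sqr_ge0. Qed.

Lemma enorm_ge0 u : 0 <= enorm u.
Proof. exact: sqrtr_ge0. Qed.

Lemma sqr_enorm u : enorm u ^+ 2 = dot u u.
Proof. by rewrite sqr_sqrtr ?dot_ge0. Qed.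

Lemma enorm0_eq0 u : enorm u = 0 -> u = 0.
Proof.
move=> u0; apply/rowP => i; rewrite mxE; apply/eqP.
have /eqP : dot u u = 0 by rewrite -sqr_enorm u0 expr0n.
rewrite psumr_eq0 => [/allP/(_ i)|j _]; last by rewrite -expr2 sqr_ge0.
by rewrite mem_index_enum mulf_eq0 orbb; apply.
Qed.

Lemma dot0l v : dot 0 v = 0.
Proof. by rewrite -(scale0r 0) dotZl mul0r. Qed.

Lemma enorm0 : enorm (0 : 'rV[R]_d) = 0.
Proof. by rewrite /enorm dot0l sqrtr0. Qed.

Lemma enormZ a u : enorm (a *: u) = `|a| * enorm u.
Proof. by rewrite /enorm !dotE mulrA sqrtrM -?expr2 ?sqr_ge0// sqrtr_sqr. Qed.

Lemma enormN u : enorm (- u) = enorm u.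
Proof. by rewrite /enorm !dotE opprK. Qed.

Lemma enormB u v : enorm (u - v) = enorm (v - u).
Proof. by rewrite -enormN opprB. Qed.

(** Cauchy-Schwarz, by expanding the nonnegative square of [enorm v *: u - enorm u *: v]. *)
Lemma dot_le_enorm u v : dot u v <= enorm u * enorm v.
Proof.
have [/enorm0_eq0 ->|u0] := eqVneq (enorm u) 0; first by rewrite dot0l enorm0 mul0r.
have [/enorm0_eq0 ->|v0] := eqVneq (enorm v) 0.
  by rewrite dotC dot0l enorm0 mulr0.
have uv_gt0 : 0 < enorm u * enorm v by rewrite mulr_gt0// lt_def enorm_ge0 ?u0 ?v0.
have := dot_ge0 (enorm v *: u - enorm u *: v).
rewrite !dotE (dotC v u) -!sqr_enorm => h.
by rewrite -(ler_pM2l uv_gt0); lra.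
Qed.

Lemma ler_enormD u v : enorm (u + v) <= enorm u + enorm v.
Proof.
rewrite -(ler_pXn2r (_ : 0 < 2)%N) ?nnegrE ?addr_ge0 ?enorm_ge0//.
have := dot_le_enorm u v.
by rewrite sqrrD !sqr_enorm !dotE (dotC v u); lra.
Qed.

Lemma ler_enormB u v w : enorm (u - w) <= enorm (u - v) + enorm (v - w).
Proof. by have := ler_enormD (u - v) (v - w); rewrite addrA subrK. Qed.

Lemma coord_le_enorm u i : `|u 0 i| <= enorm u.
Proof.
rewrite -sqrtr_sqr ler_wsqrtr// /dot (bigD1 i)//= -expr2 lerDl.
by apply: sumr_ge0 => j _; rewrite -expr2 sqr_ge0.
Qed.

(** A crude factor suffices: it only turns a Lipschitz bound in [enorm] into continuity for the sup
    norm. *)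
Lemma enorm_le_norm u : enorm u <= d%:R * `|u|.
Proof.
rewrite -[leRHS]ger0_norm ?mulr_ge0// -sqrtr_sqr ler_wsqrtr// /dot.
have ui i : u 0 i * u 0 i <= `|u| ^+ 2.
  rewrite -expr2 -real_normK ?num_real// ler_pXn2r ?nnegrE//.
  by rewrite [leRHS]mx_normrE (le_bigmax _ (fun ij => `|u ij.1 ij.2|) (0, i)).
apply: (le_trans (ler_sum _ (fun i _ => ui i))).
rewrite sumr_const card_ord -[leLHS]mulr_natl exprMn.
rewrite ler_wpM2r ?sqr_ge0//.
by rewrite -natrX ler_nat; case: (d) => // n; rewrite leq_pmulr.
Qed.

Lemma norm_le_enorm u : `|u| <= enorm u.
Proof.
rewrite [leLHS]mx_normrE; apply/bigmax_leP; split; first exact: enorm_ge0.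
by move=> [i j] _; rewrite (ord1 i) coord_le_enorm.
Qed.

(** Compactness of [K] and continuity on it; this supplies the attained minimum that [is_regret]
    demands. *)
Lemma lipschitz_in_attains_min {K} {Rad M : R} {F : 'rV[R]_d -> R} :
  closed K -> K !=set0 -> (forall x, K x -> enorm x <= Rad) ->
  0 <= M -> lipschitz_in K M F ->
  exists2 x, K x & forall y, K y -> F x <= F y.
Proof.
move=> Kcl K0 KR M0 FM.
have Kco : compact K.
  apply: bounded_closed_compact => //; exists Rad; split; first exact: num_real.
  move=> r Rr x Kx; apply: (le_trans (norm_le_enorm x)).
  by apply: (le_trans (KR x Kx)); exact: ltW.
have Fc : {within K, continuous F}.
  apply/subspace_continuousP => x Kx; apply/cvgrPdist_lt => e e0.
  (* The added 1 keeps [c] positive when [M * d%:R] vanishes, so that dividing [e] by it is safe. *)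
  pose c := M * d%:R + 1.
  have c0 : 0 < c by rewrite ltr_wpDl// mulr_ge0.
  rewrite near_withinE; near=> y => Ky.
  apply: (le_lt_trans (FM _ _ Kx Ky)).
  apply: (@le_lt_trans _ _ (c * `|x - y|)).
    apply: (le_trans (ler_wpM2l M0 (enorm_le_norm _))).
    by rewrite mulrA ler_wpM2r// lerDl.
  rewrite mulrC -ltr_pdivlMr//.
  by near: y; apply: cvgr_dist_lt => //; rewrite divr_gt0.
have [x /set_mem Kx xmin] := EVT_min_rV K0 Kco Fc.
by exists x => // y Ky; apply: xmin; rewrite inE.
Unshelve. all: by end_near. Qed.

(** The segment from [p] to [z] stays in [K], so minimality of [p] forces a nonpositive inner
    product of [y - p] and [z - p]; expanding [y - z] around [p] concludes. *)
Lemma projection_nonexpansive {K y p z} :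
  convex_set K -> is_projection K y p -> K z -> enorm (p - z) <= enorm (y - z).
Proof.
move=> Kcvx [Kp pmin] Kz.
have obtuse (a : R) : 0 < a -> a <= 1 ->
    2 * dot (y - p) (z - p) <= a * enorm (z - p) ^+ 2.
  move=> a0 a1.
  have ai : Itv.spec (@Itv.num_sem R) (Itv.Real `[0%Z, 1%Z]) a.
    by rewrite /Itv.spec /Itv.num_sem /= num_real in_itv/= ltW.
  have Kq : K (p + a *: (z - p)).
    have /set_mem := Kcvx z p (Itv.mk ai) (mem_set Kz) (mem_set Kp).
    rewrite /conv /= /unstable.onem.
    suff -> : p + a *: (z - p) = a *: z + (1 - a) *: p by [].
    by rewrite scalerBr scalerBl scale1r addrCA.
  have := pmin _ Kq.
  rewrite -(ler_pXn2r (_ : 0 < 2)%N) ?nnegrE ?enorm_ge0// !sqr_enorm.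
  rewrite (_ : y - (p + a *: (z - p)) = (y - p) - a *: (z - p)); last first.
    by rewrite opprD addrA.
  move: (z - p) (y - p) => w q; rewrite !dotE (dotC w q) => h.
  by rewrite -(ler_pM2l a0); lra.
have h : dot (y - p) (z - p) <= 0.
  rewrite leNgt; apply/negP => c0.
  have h1 := obtuse 1 ltr01 (lexx _).
  have n0 : 0 < enorm (z - p) ^+ 2 by lra.
  (* For a positive inner product c, this [a] yields 2c <= c; if it exceeds 1, the endpoint 1
     already gives 2c <= |z - p|^2 < c. *)
  pose a := dot (y - p) (z - p) / enorm (z - p) ^+ 2.
  have a0 : 0 < a by rewrite divr_gt0.
  have [a1|a1] := leP a 1.
    by have := obtuse _ a0 a1; rewrite /a divfK ?gt_eqF//; lra.
  by move: a1; rewrite ltr_pdivlMr//; lra.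
rewrite -(ler_pXn2r (_ : 0 < 2)%N) ?nnegrE ?enorm_ge0// !sqr_enorm.
have -> : y - z = (y - p) - (z - p) by rewrite opprB addrA subrK.
have -> : p - z = - (z - p) by rewrite opprB.
move: h; move: (z - p) (y - p) => w q; have := dot_ge0 q.
by rewrite !dotE (dotC w q); lra.
Qed.

End EuclideanSpace.

(** * Harmonic numbers and summation identities *)

Section Harmonic.
Context {R : realType}.
Implicit Types (n : nat).

Lemma H_recr n : H n.+1 = H n + n.+1%:R^-1 :> R.
Proof. by rewrite /H big_nat_recr. Qed.

Lemma H_ge1 {n} : (0 < n)%N -> 1 <= H n :> R.
Proof.
move=> n0; rewrite /H big_ltn// invr1 lerDl.
by apply: sumr_ge0 => i _; rewrite invr_ge0.
Qed.

Lemma ler_H {m n} : (m <= n)%N -> H m <= H n :> R.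
Proof.
move=> /subnK <-; elim: (n - m)%N => [|k IH]; rewrite ?add0n// addSn H_recr.
by apply: (le_trans IH); rewrite lerDl invr_ge0.
Qed.

(** Each new term is at most the increment of [ln], by ln(1 + x) <= x at the negative reciprocal of
    the new index. *)
Lemma H_le_1Dln {n} : (0 < n)%N -> H n <= 1 + ln n%:R :> R.
Proof.
elim: n => // -[_ _|n IH _]; first by rewrite /H big_nat1 invr1 ln1 addr0.
rewrite H_recr; apply: (le_trans (lerD (IH isT) (lexx _))).
rewrite -addrA lerD2l -lerBrDl.
have n1 : 0 < n.+1%:R :> R by rewrite ltr0n.
have n2 : 0 < n.+2%:R :> R by rewrite ltr0n.
have -> : ln n.+2%:R - ln n.+1%:R = - ln (1 + - n.+2%:R^-1) :> R.
  have -> : 1 + - n.+2%:R^-1 = n.+1%:R / n.+2%:R :> R.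
    by rewrite -[n.+1%:R](addrK 1) natr1 mulrBl divff ?gt_eqF// mul1r.
  by rewrite ln_div ?posrE// opprB.
rewrite lerNr le_ln1Dx// ltrN2 invf_lt1//.
by rewrite ltr1n.
Qed.

Lemma sum_shift (F : nat -> R) m k :
  \sum_(1 <= s < (k + m).+1) F s =
  \sum_(1 <= s < m.+1) F (s + k)%N + \sum_(1 <= s < k.+1) F s.
Proof.
rewrite (big_cat_nat (n := k.+1))//= ?ltnS ?leq_addr// addrC; congr (_ + _).
by rewrite -{1}(add1n k) big_addn subSn ?leq_addr// addKn.
Qed.

(** Abel summation. The weight [s] is the inverse step size up to [gamma]; the unweighted sum left
    over is what strong convexity cancels, [k] rounds out of phase. *)
Lemma sum_telescope_weighted (F : nat -> R) m k :
  \sum_(1 <= s < m.+1) s%:R * (F (s + k)%N - F (s + k).+1) =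
  \sum_(1 <= s < m.+1) F (s + k)%N - m%:R * F (k + m).+1.
Proof.
elim: m => [|m IH]; first by rewrite !big_geq// mul0r subr0.
by rewrite big_nat_recr//= IH [in RHS]big_nat_recr//= addSn (addnC m) addnS -natr1; ring.
Qed.

(** Bookkeeping on bare sequences: [r] is the gap of a round, [a] the squared distance to the
    competitor, [C] the path length, [z] the final distance. *)
Lemma sum_regret_le {tau m : nat} {r a C : nat -> R} {L z B gamma : R} :
  0 <= gamma -> 0 <= L ->
  (forall s, 0 <= a s) -> (forall s, 0 <= C s) -> a (tau + m).+1 = z ^+ 2 ->
  (forall s, (1 <= s <= m)%N ->
    r s <= gamma / 2 * (s%:R * (a (s + tau)%N - a (s + tau).+1)) + B * s%:R^-1
           + L * (C (s + tau)%N - C s) - gamma / 2 * a s) ->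
  (forall s, (m < s <= tau + m)%N ->
    r s <= L * (C (tau + m).+1 - C s) + L * z - gamma / 2 * a s) ->
  \sum_(1 <= s < (tau + m).+1) r s <=
  B * H m + tau%:R * (L * C (tau + m).+1 + L * z) - gamma / 2 * m%:R * z ^+ 2.
Proof.
move=> g0 L0 a0 C0 az early late.
have splitm (F : nat -> R) : \sum_(1 <= s < (tau + m).+1) F s =
    \sum_(1 <= s < m.+1) F s + \sum_(m.+1 <= s < (tau + m).+1) F s.
  by rewrite (big_cat_nat (n := m.+1))//= ltnS leq_addl.
have := sum_shift a m tau; have := sum_shift C m tau.
rewrite (splitm a) (splitm C) (splitm r) => Cshift ashift.
have {early} : \sum_(1 <= s < m.+1) r s <=
    gamma / 2 * (\sum_(1 <= s < m.+1) a (s + tau)%N - m%:R * z ^+ 2) + B * H m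
    + L * (\sum_(1 <= s < m.+1) C (s + tau)%N - \sum_(1 <= s < m.+1) C s)
    - gamma / 2 * \sum_(1 <= s < m.+1) a s.
  rewrite -az -sum_telescope_weighted /H -sumrB !mulr_sumr -!big_split -sumrN -big_split/=.
  by rewrite big_nat [leRHS]big_nat; apply: ler_sum.
have {late} : \sum_(m.+1 <= s < (tau + m).+1) r s <=
    tau%:R * (L * C (tau + m).+1 + L * z)
    - L * \sum_(m.+1 <= s < (tau + m).+1) C s
    - gamma / 2 * \sum_(m.+1 <= s < (tau + m).+1) a s.
  have -> : tau%:R * (L * C (tau + m).+1 + L * z) =
      \sum_(m.+1 <= s < (tau + m).+1) (L * C (tau + m).+1 + L * z).
    by rewrite big_const_nat iter_addr_0 subSS addnK mulr_natl.
  rewrite !mulr_sumr -!sumrN -!big_split/= big_nat [leRHS]big_nat.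
  by apply: ler_sum => s /late; lra.
(* After the shifts, the sums of [a] and [C] cancel except over the first [tau] rounds, where they
   enter negatively and are dropped. *)
have : 0 <= gamma / 2 * \sum_(1 <= s < tau.+1) a s.
  by rewrite mulr_ge0 ?divr_ge0 ?sumr_ge0.
have : 0 <= L * \sum_(1 <= s < tau.+1) C s by rewrite mulr_ge0 ?sumr_ge0.
move/(congr1 (fun x => L * x)): Cshift; move/(congr1 (fun x => gamma / 2 * x)): ashift.
by lra.
Qed.

End Harmonic.

(** * Consequences of boundedness and strong convexity *)

Section DelayedDescent.
Context {R : realType} {d : nat}.
Context {K : set 'rV[R]_d} {Rad : R}.
Hypotheses (Kcvx : convex_set K) (KR : forall x, K x -> enorm x <= Rad).

Lemma enormB_le_diameter {x y : 'rV[R]_d} : K x -> K y -> enorm (x - y) <= 2 * Rad.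
Proof.
move=> /KR Rx /KR Ry; have := ler_enormD x (- y).
by rewrite enormN; lra.
Qed.

Lemma lipschitz_in_sum {f : nat -> 'rV[R]_d -> R} {L} n :
  (forall t, (1 <= t)%N -> lipschitz_in K L (f t)) ->
  lipschitz_in K (n%:R * L) (fun x => \sum_(1 <= t < n.+1) f t x).
Proof.
move=> fL x y Kx Ky; rewrite -sumrB; apply: (le_trans (ler_norm_sum _ _ _)).
have -> : n%:R * L * enorm (x - y) = \sum_(1 <= t < n.+1) L * enorm (x - y).
  by rewrite big_const_nat iter_addr_0 subSS subn0 -mulrA mulr_natl.
by rewrite big_nat [leRHS]big_nat; apply: ler_sum => t /andP[t1 _]; exact: fL.
Qed.

Lemma strongly_convex_gap_le {gamma} {f : 'rV[R]_d -> R} {g} x y :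
  strongly_convex gamma f g ->
  f x - f y <= dot (g x) (x - y) - gamma / 2 * enorm (x - y) ^+ 2.
Proof.
move=> /(_ y x); rewrite (enormB y x) -(opprB x y) dotNr; lra.
Qed.

(** The maximum of L q - gamma/2 q^2 over the distance q. *)
Lemma strongly_convex_gap_le_sqr {gamma L} {f : 'rV[R]_d -> R} {g} x y :
  0 < gamma -> strongly_convex gamma f g -> enorm (g x) <= L ->
  f x - f y <= L ^+ 2 / (2 * gamma).
Proof.
move=> g0 fg gL; apply: (le_trans (strongly_convex_gap_le _ _ fg)).
apply: (le_trans (lerB (dot_le_enorm _ _) (lexx _))).
have := ler_wpM2r (enorm_ge0 (x - y)) gL; set z := enorm (x - y) => h.
rewrite ler_pdivlMr; last by rewrite mulr_gt0.
have := sqr_ge0 (L - gamma * z); have := ler_wpM2r (ltW g0) h.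
by lra.
Qed.

(** * One step of the run *)

Context {tau : nat} {L gamma : R} {xk xhat : nat -> 'rV[R]_d}.
Context {eta beta lambda : nat -> R} {grad : nat -> 'rV[R]_d -> 'rV[R]_d}.
Hypotheses (K0 : K 0) (gamma_gt0 : 0 < gamma).
Hypothesis xkK : forall t, (1 <= t)%N -> K (xk t).
Hypothesis gradL : forall t x, (1 <= t)%N -> K x -> enorm (grad t x) <= L.
Hypothesis params : forall t, (tau < t)%N ->
  let s := 1 / (gamma * (t - tau)%:R) in
  [/\ eta t = s, beta t = s & `|lambda t| = s].
Hypothesis run :
  DCOGD_run K tau eta beta (fun t x => lambda t *: x) grad xk xhat.

Let L' := L + Rad / gamma.
(** As [eta t = beta t], the influence term folds into the gradient with ratio 1, leaving an
    ordinary projected gradient step. *)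
Let modified_grad t : 'rV[R]_d := grad (t - tau) (xhat (t - tau)%N) - lambda t.+1 *: xk t.+1.

Lemma Rad_ge0 : 0 <= Rad.
Proof. by rewrite -(@enorm0 R d) KR. Qed.

Lemma xhat_init {t} : (1 <= t <= tau.+1)%N -> xhat t = 0.
Proof. by case: run => + _; exact. Qed.

Lemma xhat_in {t} : (1 <= t)%N -> K (xhat t).
Proof.
move=> t1; have [taut|] := leqP t tau.+1; first by rewrite xhat_init ?t1.
case: t t1 => // t _ taut; case: run => _ /(_ t taut)/= [inK outK].
by have [yK|yK] := EM (K (xhat t - eta t *: grad (t - tau)%N (xhat (t - tau)%N) +
    beta t *: (lambda t.+1 *: xk t.+1))); [rewrite inK|case: (outK yK)].
Qed.

Lemma step_contracts {t z} : (tau < t)%N -> K z ->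
  enorm (xhat t.+1 - z) <= enorm (xhat t - z - eta t *: modified_grad t).
Proof.
move=> taut Kz; case: run => _ /(_ t taut)/=.
have [-> -> _] := params _ taut; set s := 1 / _.
have -> : xhat t - s *: grad (t - tau)%N (xhat (t - tau)%N) +
    s *: (lambda t.+1 *: xk t.+1) = xhat t - s *: modified_grad t.
  by rewrite /modified_grad scalerBr opprB addrA addrAC.
rewrite (addrAC _ (- z)); set y := xhat t - s *: _ => -[inK outK].
have [yK|yK] := EM (K y); first by rewrite inK.
exact: (projection_nonexpansive Kcvx (outK yK) Kz).
Qed.

(** The step at [t] uses the influence of round [t.+1], whose denominator is larger by [gamma]. The
    first bound controls the influence error, the second gives [L']. *)
Lemma lambda_next {t} : (tau < t)%N ->
  `|lambda t.+1| <= (gamma * (t - tau)%:R)^-1 /\ `|lambda t.+1| <= gamma^-1.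
Proof.
move=> taut; have [_ _ ->] := params _ (ltnW taut : (tau < t.+1)%N).
rewrite div1r subSn ?(ltnW taut)//.
have k0 : 0 < (t - tau)%:R :> R by rewrite ltr0n subn_gt0.
have k1 : 1 <= (t - tau).+1%:R :> R by rewrite ler1n.
split; rewrite lef_pV2 ?posrE ?mulr_gt0//.
- by rewrite ler_pM2l// ler_nat.
- by rewrite ler_peMr// ltW.
Qed.

Lemma modified_grad_le {t} : (tau < t)%N -> enorm (modified_grad t) <= L'.
Proof.
move=> taut; apply: (le_trans (ler_enormD _ _)); rewrite enormN enormZ; apply: lerD.
  by apply: gradL; [rewrite subn_gt0|apply: xhat_in; rewrite subn_gt0].
have [_ h] := lambda_next taut; rewrite mulrC.
by apply: ler_pM; rewrite ?enorm_ge0 ?normr_ge0// KR//; exact: xkK.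
Qed.

Lemma step_length_le {t} : (tau < t)%N ->
  enorm (xhat t.+1 - xhat t) <= L' / gamma * (t - tau)%:R^-1.
Proof.
move=> taut.
(* The competitor is the current iterate itself. *)
have := step_contracts taut (xhat_in (leq_ltn_trans (leq0n _) taut)).
move=> /le_trans; apply; rewrite subrr sub0r enormN enormZ.
have [-> _ _] := params _ taut; rewrite div1r ger0_norm; last first.
  by rewrite invr_ge0 mulr_ge0 // ltW.
rewrite -mulrA -invfM mulrC ler_wpM2r ?modified_grad_le//.
by rewrite invr_ge0 mulr_ge0 // ltW.
Qed.

(** The usual expansion of the squared distance, with the delayed gradient paired with the iterate
    it moves. Removing the influence term costs at most [Rad * (2 * Rad)] times the step size. *)
Lemma linearized_gap_le {t z} : (tau < t)%N -> K z ->
  dot (grad (t - tau) (xhat (t - tau)%N)) (xhat t - z) <=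
  gamma / 2 * ((t - tau)%:R * (enorm (xhat t - z) ^+ 2 - enorm (xhat t.+1 - z) ^+ 2))
  + (L' ^+ 2 / 2 + 2 * Rad ^+ 2) / gamma * (t - tau)%:R^-1.
Proof.
move=> taut Kz; have t0 := leq_ltn_trans (leq0n _) taut.
have k0 : 0 < (t - tau)%:R :> R by rewrite ltr0n subn_gt0.
set k := (t - tau)%:R in k0 *.
have c0 : 0 < gamma * k by rewrite mulr_gt0.
have lin : dot (lambda t.+1 *: xk t.+1) (xhat t - z) <= 2 * Rad ^+ 2 / (gamma * k).
  apply: (le_trans (dot_le_enorm _ _)); rewrite enormZ -[leLHS]mulrA [leLHS]mulrC.
  have -> : 2 * Rad ^+ 2 / (gamma * k) = Rad * (2 * Rad) * (gamma * k)^-1 by lra.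
  have [h _] := lambda_next taut.
  apply: ler_pM => //; first by rewrite mulr_ge0 ?enorm_ge0.
  apply: ler_pM; rewrite ?enorm_ge0//; first by apply: KR; exact: xkK.
  by apply: enormB_le_diameter => //; exact: xhat_in.
have := step_contracts taut Kz.
rewrite -(ler_pXn2r (_ : 0 < 2)%N) ?nnegrE ?enorm_ge0//.
have [-> _ _] := params _ taut; rewrite -/k div1r.
have : enorm (modified_grad t) ^+ 2 <= L' ^+ 2.
  rewrite ler_pXn2r ?nnegrE ?enorm_ge0 ?modified_grad_le//.
  exact: le_trans (enorm_ge0 _) (modified_grad_le taut).
rewrite {1}sqr_enorm.
have -> : grad (t - tau)%N (xhat (t - tau)%N) =
    modified_grad t + lambda t.+1 *: xk t.+1 by rewrite subrK.
rewrite dotDl; move: lin; set l := dot (_ *: _) _ => lin.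
move: (enorm (xhat t.+1 - z) ^+ 2) => a'.
rewrite !sqr_enorm; move: (modified_grad t) (xhat t - z) => G w.
rewrite !dotE (dotC w G) => GL aw.
set i := (gamma * k)^-1 in lin aw *.
have i0 : 0 < i by rewrite invr_gt0.
have ci : gamma * k * i = 1 by rewrite divff ?gt_eqF.
have step : 2 * i * dot G w <= dot w w - a' + i * (i * L' ^+ 2).
  have : i * (i * dot G G) <= i * (i * L' ^+ 2) by rewrite !ler_pM2l.
  by lra.
(* Multiplying by the inverse step size; the products are regrouped so that [ci] cancels one factor
   [i]. *)
have := ler_wpM2l (ltW c0) step.
have -> : (L' ^+ 2 / 2 + 2 * Rad ^+ 2) / gamma * k^-1 = (L' ^+ 2 / 2 + 2 * Rad ^+ 2) * i.
  by rewrite -[LHS]mulrA -invfM.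
have -> : gamma * k * (2 * i * dot G w) = gamma * k * i * (2 * dot G w) by ring.
have -> : gamma * k * (dot w w - a' + i * (i * L' ^+ 2)) =
  gamma * k * (dot w w - a') + gamma * k * i * (i * L' ^+ 2) by ring.
by rewrite ci; lra.
Qed.

(** * Length of the path of iterates *)

Let path_length t : R := \sum_(1 <= j < t) enorm (xhat j.+1 - xhat j).

Lemma path_length_ge0 t : 0 <= path_length t.
Proof. by apply: sumr_ge0 => j _; exact: enorm_ge0. Qed.

Lemma enormB_le_path_length {s t} : (1 <= s <= t)%N ->
  enorm (xhat s - xhat t) <= path_length t - path_length s.
Proof.
case/andP=> s1; elim: t => [|t IH]; first by rewrite leqNgt s1.
rewrite leq_eqVlt ltnS => /predU1P[->|st]; first by rewrite !subrr enorm0.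
apply: (le_trans (ler_enormB _ (xhat t) _)).
rewrite /path_length big_nat_recr ?(leq_trans s1 st)//= addrAC.
by apply: lerD; [exact: IH|rewrite enormB].
Qed.

(* The first actual move is bounded by the diameter of [K] instead of [L' / gamma]:
   this saving pays for the last [tau] rounds, whose feedback is never used. *)
Lemma path_length_le m :
  path_length (tau + m.+1).+1 <= 2 * Rad + L' / gamma * (H m.+1 - 1).
Proof.
elim: m => [|m IH].
  (* The iterates of rounds 1 to [tau.+1] are all 0, so only the last summand survives. *)
  rewrite /path_length addn1 big_nat_recr//= big_nat big1 => [|j]; last first.
    by case/andP=> j1 jt; rewrite !xhat_init ?j1 ?ltnS// ?subr0 ?enorm0// ltnW.
  rewrite add0r /H big_nat1 invr1 subrr mulr0 addr0.
  by apply: enormB_le_diameter; exact: xhat_in.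
have -> : path_length (tau + m.+2).+1 = path_length (tau + m.+1).+1 +
    enorm (xhat (tau + m.+2).+1 - xhat (tau + m.+2)%N).
  by rewrite -(addnS tau m.+1) [LHS]big_nat_recr ?addnS.
have tm : (tau < tau + m.+2)%N by rewrite addnS ltnS leq_addr.
rewrite H_recr; apply: (le_trans (lerD IH (step_length_le tm))).
by rewrite addKn -addrA -mulrDr (addrAC (H _)).
Qed.

(** * Regret against a fixed competitor *)

Context {f : nat -> 'rV[R]_d -> R}.
Hypothesis fsc : forall t, (1 <= t)%N -> strongly_convex gamma (f t) (grad t).

(** With [tau <= m] the negative quadratic term of weight [m] may be weakened to weight [tau], so
    that the remainder is [tau] times one scalar inequality. *)
Lemma regret_le_long {m z} : 0 <= L -> (0 < tau)%N -> (tau <= m)%N -> K z ->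
  \sum_(1 <= s < (tau + m).+1) (f s (xhat s) - f s z) <=
  (L' ^+ 2 / 2 + 2 * Rad ^+ 2) / gamma * H m
  + tau%:R * (2 * gamma * Rad ^+ 2 + L * L' / gamma * H m).
Proof.
move=> L0 tau0 tm Kz.
have dotL s u : (1 <= s)%N -> dot (grad s (xhat s)) u <= L * enorm u.
  move=> s1; apply: (le_trans (dot_le_enorm _ _)).
  by rewrite ler_wpM2r ?enorm_ge0// gradL//; exact: xhat_in.
have := @sum_regret_le R tau m (fun s => f s (xhat s) - f s z)
  (fun s => enorm (xhat s - z) ^+ 2) path_length L (enorm (xhat (tau + m).+1 - z))
  ((L' ^+ 2 / 2 + 2 * Rad ^+ 2) / gamma) gamma (ltW gamma_gt0) L0
  (fun s => sqr_ge0 _) path_length_ge0 erefl.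
have early s : (1 <= s <= m)%N ->
    f s (xhat s) - f s z <= gamma / 2 * (s%:R * (enorm (xhat (s + tau)%N - z) ^+ 2
      - enorm (xhat (s + tau).+1 - z) ^+ 2))
    + (L' ^+ 2 / 2 + 2 * Rad ^+ 2) / gamma * s%:R^-1
    + L * (path_length (s + tau)%N - path_length s)
    - gamma / 2 * enorm (xhat s - z) ^+ 2.
  case/andP=> s1 _.
  apply: (le_trans (strongly_convex_gap_le _ _ (fsc _ s1))); rewrite lerD2r.
  (* The gradient of round [s] acts at round [s + tau]; the drift in between is charged to the path
     length. *)
  have -> : xhat s - z = (xhat (s + tau)%N - z) + (xhat s - xhat (s + tau)%N).
    by rewrite [RHS]addrC addrA subrK.
  rewrite dotDr; apply: lerD.
    have := @linearized_gap_le (s + tau) z; rewrite addnK; apply => //.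
    by rewrite -[ltnLHS]add0n ltn_add2r.
  apply: (le_trans (dotL _ _ s1)); rewrite ler_wpM2l// enormB_le_path_length//.
  by rewrite s1 leq_addr.
have late s : (m < s <= tau + m)%N ->
    f s (xhat s) - f s z <= L * (path_length (tau + m).+1 - path_length s)
    + L * enorm (xhat (tau + m).+1 - z) - gamma / 2 * enorm (xhat s - z) ^+ 2.
  case/andP=> ms sT; have s1 := leq_ltn_trans (leq0n _) ms.
  apply: (le_trans (strongly_convex_gap_le _ _ (fsc _ s1))); rewrite lerD2r.
  apply: (le_trans (dotL _ _ s1)); rewrite -mulrDr ler_wpM2l//.
  apply: (le_trans (ler_enormB _ (xhat (tau + m).+1) _)); rewrite lerD2r.
  by rewrite enormB_le_path_length// s1 ltnW.
move=> /(_ early late)/le_trans; apply; rewrite -addrA lerD2l.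
have := path_length_le m.-1; rewrite prednK ?(leq_trans tau0)//.
set P := path_length _; set z1 := enorm _; set h := H m => PL.
have LL' : L <= L' by rewrite /L' lerDl divr_ge0 ?Rad_ge0 ?ltW.
have {}PL : L * P <= L * (2 * Rad + L' / gamma * (h - 1)) by rewrite ler_wpM2l.
have tm' : tau%:R * (gamma / 2 * z1 ^+ 2) <= m%:R * (gamma / 2 * z1 ^+ 2).
  by rewrite ler_wpM2r ?ler_nat// mulr_ge0 ?sqr_ge0 ?divr_ge0 ?ltW.
suff : L * P + L * z1 - gamma / 2 * z1 ^+ 2 <=
    2 * gamma * Rad ^+ 2 + L * L' / gamma * h.
  by move/(ler_wpM2l (ler0n R tau)); lra.
(* The two completed squares are [(L - 2 gamma Rad)^2] and [(L - gamma z1)^2]. *)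
have sq : 2 * Rad * L - L * L' / gamma + L * z1 - gamma / 2 * z1 ^+ 2 <=
    2 * gamma * Rad ^+ 2.
  have := sqr_ge0 (L - 2 * (gamma * Rad)); have := sqr_ge0 (L - gamma * z1).
  (* [L * L <= L * L'] provides the half of [L ^+ 2] needed by each square; scaling by [gamma]
     clears the division. *)
  have := ler_wpM2l L0 LL'.
  rewrite -subr_ge0 -(pmulr_rge0 _ gamma_gt0) => h1 h2 h3.
  rewrite -subr_ge0 -(pmulr_rge0 _ gamma_gt0).
  have -> : gamma * (2 * gamma * Rad ^+ 2 - (2 * Rad * L - L * L' / gamma + L * z1 -
      gamma / 2 * z1 ^+ 2)) = 2 * (gamma * Rad) ^+ 2 - 2 * (gamma * Rad) * L + L * L'
      - L * (gamma * z1) + (gamma * z1) ^+ 2 / 2.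
    by field; rewrite gt_eqF.
  by move: h1; rewrite (pmulr_rge0 _ gamma_gt0); lra.
by lra.
Qed.

(** At most [2 * tau] rounds, each costing at most [L ^+ 2 / (2 * gamma)]. *)
Lemma regret_le_short {m} z : (m <= tau)%N ->
  \sum_(1 <= s < (tau + m).+1) (f s (xhat s) - f s z) <= tau%:R * (L ^+ 2 / gamma).
Proof.
move=> mt.
have -> : tau%:R * (L ^+ 2 / gamma) = (tau + tau)%:R * (L ^+ 2 / (2 * gamma)).
  by rewrite natrD; field; rewrite gt_eqF.
have c0 : 0 <= L ^+ 2 / (2 * gamma) by rewrite divr_ge0 ?sqr_ge0// mulr_ge0// ltW.
apply: (@le_trans _ _ ((tau + m)%:R * (L ^+ 2 / (2 * gamma)))); last first.
  by rewrite ler_wpM2r// ler_nat leq_add2l.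
have -> : (tau + m)%:R * (L ^+ 2 / (2 * gamma)) =
    \sum_(1 <= s < (tau + m).+1) L ^+ 2 / (2 * gamma).
  by rewrite big_const_nat iter_addr_0 subSS subn0 mulr_natl.
rewrite big_nat [leRHS]big_nat; apply: ler_sum => s /andP[s1 _].
by apply: strongly_convex_gap_le_sqr (fsc _ s1) _ => //; apply: gradL => //; exact: xhat_in.
Qed.

Lemma regret_le {T z} : 0 <= L -> (0 < tau)%N -> (tau < T)%N -> K z ->
  \sum_(1 <= s < T.+1) f s (xhat s) - \sum_(1 <= s < T.+1) f s z <=
  2 * gamma * tau%:R * Rad ^+ 2 + 2 * Rad ^+ 2 / gamma * H T
  + (1 / 2 + tau%:R) * L' ^+ 2 * (1 / gamma) * H (T - tau)%N.
Proof.
move=> L0 tau0 tT Kz; rewrite -sumrB.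
have := subnKC (ltnW tT); set m := (T - tau)%N => mT.
have LL' : L <= L' by rewrite /L' lerDl divr_ge0 ?Rad_ge0 ?ltW.
have Hm1 : 1 <= H m :> R by rewrite H_ge1// subn_gt0.
have gi : 0 <= gamma^-1 by rewrite invr_ge0 ltW.
have t0 : 0 <= tau%:R :> R by [].
have A0 : 0 <= tau%:R * gamma * Rad ^+ 2.
  by rewrite mulr_ge0 ?sqr_ge0// mulr_ge0// ltW.
have HmT : Rad ^+ 2 * gamma^-1 * H m <= Rad ^+ 2 * gamma^-1 * H T.
  by rewrite ler_wpM2l ?(mulr_ge0 (sqr_ge0 _))// ler_H// leq_subr.
have L'0 : 0 <= L' := le_trans L0 LL'.
(* In the short case, [L <= L'] and [1 <= H m] let the term of the bound with factor [tau * L' ^+ 2]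
   absorb the whole regret. *)
have [tm|mt] := leqP tau m; last first.
  have := regret_le_short z (ltnW mt); rewrite mT => /le_trans; apply.
  have : tau%:R * gamma^-1 * L ^+ 2 <= tau%:R * gamma^-1 * (L' ^+ 2 * H m).
    apply: ler_wpM2l; first by rewrite mulr_ge0.
    rewrite -[leLHS]mulr1; apply: ler_pM; rewrite ?sqr_ge0//.
    by rewrite ler_pXn2r.
  have : 0 <= Rad ^+ 2 * gamma^-1 * H m.
    by rewrite mulr_ge0 ?(mulr_ge0 (sqr_ge0 _))// (le_trans ler01).
  have : 0 <= L' ^+ 2 * gamma^-1 * H m.
    by rewrite mulr_ge0 ?(mulr_ge0 (sqr_ge0 _))// (le_trans ler01).
  by lra.
have := regret_le_long L0 tau0 tm Kz; rewrite mT => /le_trans; apply.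
have : tau%:R * gamma^-1 * H m * (L * L') <= tau%:R * gamma^-1 * H m * (L' * L').
  by rewrite ler_wpM2l ?ler_wpM2r// !mulr_ge0// (le_trans ler01).
by lra.
Qed.

End DelayedDescent.

(** * The logarithmic form of the bound, and the theorem *)

Lemma bound_le_ln {R : realType} {Rad gamma L' : R} {tau T : nat} :
  0 < gamma -> (0 < tau)%N -> (tau < T)%N ->
  2 * gamma * tau%:R * Rad ^+ 2 + 2 * Rad ^+ 2 / gamma * H T
  + (1 / 2 + tau%:R) * L' ^+ 2 * (1 / gamma) * H (T - tau)%N <=
  (2 * gamma * Rad ^+ 2 + 2 * Rad ^+ 2 / gamma + 3 / 2 * L' ^+ 2 / gamma)
  * (1 + (ln 2)^-1) * tau%:R * ln T%:R.
Proof.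
move=> g0 tau0 tT; have T2 : (2 <= T)%N := leq_ltn_trans tau0 tT.
have l2 : 0 < ln 2 :> R by rewrite ln_gt0// ltr1n.
have lT : ln 2 <= ln T%:R :> R by rewrite ler_ln ?posrE ?ltr0n ?ler_nat// ltnW.
have t1 : 1 <= tau%:R :> R by rewrite ler1n.
have := H_le_1Dln (R := R) (ltnW T2); have := ler_H (R := R) (leq_subr tau T).
set l := ln T%:R in lT *; set h := H T; set h' := H _ => h'h hT.
have l0 : 0 < l := lt_le_trans l2 lT.
have q1 : 1 <= (ln 2)^-1 * l by rewrite mulrC ler_pdivlMr// mul1r.
set q := (ln 2)^-1 in q1 *.
(* Since [T >= 2], [1 <= ln T / ln 2]; hence [Q] dominates both 1 and [1 + ln T], and so [H T]. *)
pose Q := (1 + q) * l; have hQ : h <= Q by rewrite /Q; lra.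
have Q1 : 1 <= Q by rewrite /Q; lra.
have Q0 : 0 <= Q := le_trans ler01 Q1.
have gi : 0 <= gamma^-1 by rewrite invr_ge0 ltW.
have R0 := sqr_ge0 Rad; have L0 := sqr_ge0 L'.
have t0 : 0 <= tau%:R :> R by [].
have e1 : gamma * Rad ^+ 2 * tau%:R * 1 <= gamma * Rad ^+ 2 * tau%:R * Q.
  by rewrite ler_wpM2l// mulr_ge0// mulr_ge0// ltW.
have e2 : gamma^-1 * Rad ^+ 2 * h <= gamma^-1 * Rad ^+ 2 * (tau%:R * Q).
  rewrite (ler_wpM2l (mulr_ge0 gi R0))//; apply: (le_trans hQ).
  by rewrite -[leLHS]mul1r ler_wpM2r.
(* The factor 3/2 comes from 1/2 + tau <= 3/2 tau for tau >= 1. *)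
have e3 : gamma^-1 * L' ^+ 2 * ((1 / 2 + tau%:R) * h') <=
    gamma^-1 * L' ^+ 2 * (3 / 2 * tau%:R * Q).
  rewrite (ler_wpM2l (mulr_ge0 gi L0))//.
  apply: (@le_trans _ _ ((1 / 2 + tau%:R) * Q)).
    by rewrite ler_wpM2l ?addr_ge0 ?divr_ge0// (le_trans h'h).
  by rewrite ler_wpM2r//; lra.
by move: e1 e2 e3; rewrite /Q; lra.
Qed.

(** [C2] is chosen before the dimension, the delay, the horizon and all sequences. For [tau = 0] the
    last bound would be 0, hence the positive delay. *)
Theorem theorem2 (R : realType) (L Rad gamma : R) :
  0 < L -> 0 < Rad -> 0 < gamma ->
  exists C2 : R,
  forall (d tau : nat) (K : set 'rV[R]_d) (xu xk : nat -> 'rV[R]_d)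
    (f : nat -> 'rV[R]_d -> R) (grad : nat -> 'rV[R]_d -> 'rV[R]_d)
    (eta beta lambda : nat -> R) (xhat : nat -> 'rV[R]_d),
  (0 < tau)%N ->
  closed K -> convex_set K -> K 0 -> (forall x, K x -> enorm x <= Rad) ->
  (forall t, (1 <= t)%N -> K (xu t) /\ K (xk t)) ->
  (forall t, (1 <= t)%N ->
     [/\ in_classF (xu t) (f t),
         gradient_map (f t) (grad t),
         strongly_convex gamma (f t) (grad t),
         lipschitz_in K L (f t)
       & forall x, K x -> enorm (grad t x) <= L]) ->
  (forall t, (tau < t)%N ->
     let s := 1 / (gamma * (t - tau)%:R) in
     [/\ eta t = s, beta t = s & `|lambda t| = s]) ->
  DCOGD_run K tau eta beta (fun t x => lambda t *: x) grad xk xhat ->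
  forall T : nat, (tau < T)%N ->
  let L' := L + Rad / gamma in
  let bound := 2 * gamma * tau%:R * Rad ^+ 2 + 2 * Rad ^+ 2 / gamma * H T
               + (1 / 2 + tau%:R) * L' ^+ 2 * (1 / gamma) * H (T - tau)%N in
  exists2 r : R, is_regret K f xhat T r &
    r <= bound /\ bound <= C2 * tau%:R * ln T%:R.
Proof.
move=> L_gt0 Rad_gt0 gamma_gt0.
exists ((2 * gamma * Rad ^+ 2 + 2 * Rad ^+ 2 / gamma
         + 3 / 2 * (L + Rad / gamma) ^+ 2 / gamma) * (1 + (ln 2)^-1)).
move=> d tau K xu xk f grad eta beta lambda xhat tau_gt0 Kcl Kcvx K0 KR Kx fP
  params run T tauT L' bound.
have fL t : (1 <= t)%N -> lipschitz_in K L (f t) by case/fP.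
(* The total loss is Lipschitz with constant [T%:R * L], so its minimum over [K] is attained; [z] is
   the minimizer in the regret. *)
have [z Kz zmin] := lipschitz_in_attains_min Kcl (ex_intro _ _ K0) KR
  (mulr_ge0 (ler0n R T) (ltW L_gt0)) (lipschitz_in_sum T fL).
exists (\sum_(1 <= t < T.+1) f t (xhat t) - \sum_(1 <= t < T.+1) f t z).
  by exists z.
split; last exact: bound_le_ln.
apply: (regret_le Kcvx KR K0 gamma_gt0 _ _ params run);
  rewrite ?ltW//.
- by move=> t /Kx[].
- by move=> t x /fP[_ _ _ _ +]; exact.
- by move=> t /fP[].
Qed.
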